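(* Every finite matroid $M$ has a canonical tree-decomposition $(\mathcal T,\mathcal V)$ which efficiently distinguishes all its distinguishable tangles; that is, for every two distinguishable tangles $\theta,\theta'$ in $M$ (of any orders) there is an edge of $\mathcal T$ whose associated separation of $M$ efficiently distinguishes $\theta$ from $\theta'$.
   Context: Let $M$ be a finite matroid with ground set $E$ and rank function $r$. The separations of $M$ are the bipartitions $\{A,B\}$ of $E$ ($A\cup B=E$, $A\cap B=\emptyset$, sides may be empty); the orientations of $\{A,B\}$ are $(A,B)$ and $(B,A)$, and its order is $|A,B|=r(A)+r(B)-r(E)+1$. For an integer $k\ge1$ let $S_k$ be the set of separations of order less than $k$. A $k$-tangle in $M$ is a set $\theta$ containing exactly one of the two orientations of every separation in $S_k$ (and nothing else) such that $\theta$ has no element of the form $(E\setminus\{e\},\{e\})$ with $e\in E$, and no subset of the form $\{(A_1,B_1),(A_2,B_2),(A_3,B_3)\}$ with $A_1\cup A_2\cup A_3=E$ (the three oriented separations need not be distinct). A tangle is a $k$-tangle for some $k\geq 1$. A separation $\{A,B\}$ distinguishes two tangles $\theta,\theta'$ (possibly of different orders) if $(A,B)\in\theta$ and $(B,A)\in\theta'$, or vice versa. Two tangles are distinguishable if some separation of $M$ distinguishes them; a separation distinguishes them efficiently if it has the smallest order among all separations of $M$ distinguishing them. A tree-decomposition of $M$ is a pair $(\mathcal T,\mathcal V)$ where $\mathcal T$ is a tree and $\mathcal V=(V_t)_{t\in V(\mathcal T)}$ is a partition of $E$ (a family of disjoint, possibly empty, sets with union $E$). The separation associated with an edge $e=t_1t_2$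 of $\mathcal T$ is $\{\bigcup_{t\in T_1}V_t,\bigcup_{t\in T_2}V_t\}$, where $T_i$ is the component of $\mathcal T-e$ containing $t_i$. The tree-decomposition is canonical if the automorphisms of $M$ act naturally on $\mathcal T$: they map every part $V_t$ to a part $V_{t'}$ in such a way that $t\mapsto t'$ is an automorphism of $\mathcal T$ (i.e. the automorphism group of $M$ acts on $\mathcal T$ by automorphisms $t\mapsto\alpha(t)$ with $\alpha(V_t)=V_{\alpha(t)}$). *)

(* Defs.v *)
From mathcomp Require Import all_boot all_fingroup.

Set Implicit Arguments.
Unset Strict Implicit.
Unset Printing Implicit Defensive.

(* The ground set is the whole finite type E. *)
Record matroid (E : finType) := Matroid {
  indep : pred {set E};
  indep0 : indep set0;
  indepS : forall I J : {set E}, I \subset J -> indep J -> indep I;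
  indep_augment : forall I J : {set E}, indep I -> indep J -> #|I| < #|J| ->
    exists2 x, x \in J :\: I & indep (x |: I)
}.

Section Matroid.
Variables (E : finType) (M : matroid E).
Implicit Types (A B : {set E}) (theta : {set {set E} * {set E}}).

Definition rank A : nat := \max_(I : {set E} | (I \subset A) && indep M I) #|I|.

Definition matroid_aut : {set {perm E}} :=
  [set s : {perm E} | [forall I : {set E}, indep M (s @: I) == indep M I]].

Lemma matroid_aut_group_set : group_set matroid_aut.
Proof.
apply/group_setP; split.
  rewrite inE; apply/forallP=> I.
  suff -> : (1%g : {perm E}) @: I = I by [].
  by rewrite -[RHS]imset_id; apply: eq_imset => x; rewrite perm1.
move=> s t; rewrite !inE => /forallP hs /forallP ht; apply/forallP=> I.
suff -> : (s * t)%g @: I = t @: (s @: I) by rewrite (eqP (ht _)) hs.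
by rewrite -imset_comp; apply: eq_imset => x; rewrite permM.
Qed.

Canonical matroid_aut_group := Group matroid_aut_group_set.

(* An unordered separation {A, B} is given by either of its orientations
   (A, B), (B, A); all notions about unordered separations below are symmetric
   in A and B. *)
Definition separation A B : Prop := A :|: B = setT /\ A :&: B = set0.

(* The subtraction does not truncate when A :|: B = setT: by submodularity of
   the rank, rank setT <= rank A + rank B. *)
Definition sep_order A B : nat := rank A + rank B - rank setT + 1.

Definition k_tangle (k : nat) theta : Prop :=
  [/\ forall A B, separation A B -> sep_order A B < k ->
        #|theta :&: [set (A, B); (B, A)]| = 1,
      forall A B, (A, B) \in theta -> separation A B /\ sep_order A B < k,
      forall x : E, (~: [set x], [set x]) \notin theta
    & forall A1 B1 A2 B2 A3 B3,
        (A1, B1) \in theta -> (A2, B2) \in theta -> (A3, B3) \in theta ->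
        A1 :|: A2 :|: A3 <> setT].

Definition tangle theta : Prop := exists2 k, 1 <= k & k_tangle k theta.

Definition distinguishes A B theta theta' : Prop :=
  separation A B /\
  ((A, B) \in theta /\ (B, A) \in theta' \/
   (B, A) \in theta /\ (A, B) \in theta').

Definition distinguishable theta theta' : Prop :=
  exists A B, distinguishes A B theta theta'.

Definition efficiently_distinguishes A B theta theta' : Prop :=
  distinguishes A B theta theta' /\
  forall A' B', distinguishes A' B' theta theta' ->
    sep_order A B <= sep_order A' B'.

End Matroid.

Section TreeDecomposition.
Variables (E : finType) (T : finType) (adj : rel T) (V : T -> {set E}).

(* A nonempty connected simple graph without cycles; ucycle adj also accepts
   the degenerate closed walks on at most two vertices. *)
Definition tree : Prop :=
  [/\ symmetric adj, irreflexive adj, 0 < #|T|,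
      forall x y, connect adj x y
    & forall c : seq T, ucycle adj c -> size c <= 2].

(* Parts may be empty, so this is not finset's partition. *)
Definition family_partition : Prop :=
  (forall t t', t != t' -> [disjoint V t & V t']) /\ \bigcup_t V t = setT.

Definition tree_decomposition : Prop := tree /\ family_partition.

Definition del_edge (t1 t2 : T) : rel T :=
  [rel x y | adj x y && ([set x; y] != [set t1; t2])].

(* The edge t1t2 is associated with {edge_side t1 t2, edge_side t2 t1}. *)
Definition edge_side (t1 t2 : T) : {set E} :=
  \bigcup_(t | connect (del_edge t1 t2) t1 t) V t.

(* Permutations compose from left to right, so the action on T is a right
   action: to t (a * b) = to (to t a) b. *)
Definition canonical (M : matroid E) : Prop :=
  exists to : action (matroid_aut M) T,
    forall a, a \in matroid_aut M ->
      (forall t u, adj (to t a) (to u a) = adj t u) /\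
      (forall t, a @: V t = V (to t a)).

End TreeDecomposition.

(* Main.v *)
Require Import Defs.
From mathcomp Require Import all_boot all_fingroup.
From mathcomp Require Import zify.
From mathcomp Require boolp.

Set Implicit Arguments.
Unset Strict Implicit.
Unset Printing Implicit Defensive.

(** A separation is recorded by one of its sides A, the other side being ~: A,
    and lam A denotes its order.  The order is symmetric under complement and
    submodular, which it inherits from the rank function.

    Let U be the set of all separations that efficiently distinguish some pair
    of tangles, and let x(A) be the number of members of U that cross A.  For
    each pair of tangles keep those of its efficient distinguishers whose x is
    smallest; let N be the set of all separations kept in this way
    (tangle_seps).  No choices are made, so N is invariant under the
    automorphisms of the matroid, and every distinguishable pair of tangles is
    efficiently distinguished by a member of N.  The point is that N is nested
    (least_crossed_nested).

    Indeed, suppose A and C in N cross, where A was kept for the pair (p, p')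
    and C for (q, q'), with lam A <= lam C.  Corners of crossing separations
    are crossed less often: x(A :&: C) + x(A :|: C) < x(A) + x(C)
    (crossing_number_submod).  If q and q' orient A alike, submodularity and
    the tangle axioms give two opposite corners, one of which is an efficient
    distinguisher of (p, p') and the other one of (q, q'); this contradicts the
    minimality of x(A) and x(C).  If q and q' orient A differently, then A and
    C have the same order, A is itself an efficient distinguisher of (q, q'),
    and so x(C) <= x(A).  Now either p and p' orient C alike, which is the
    previous case with the roles exchanged, or C also efficiently
    distinguishes (p, p').  Then two opposite corners both efficiently
    distinguish (p, p'), so 2 x(A) <= x(A :&: C) + x(A :|: C) < x(A) + x(C),
    contradicting x(C) <= x(A).

    It remains to turn the nested set N into a tree.  Its nodes are the
    consistent orientations of N: a side of every separation is selected, and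
    any two selected sides meet.  Two nodes are adjacent when they differ in
    one separation.  Any orientation can be moved step by step to any other by
    reversing a minimal selected side on which they differ (flip_toward), hence
    the graph is connected.  Since N is nested, an orientation in which A can
    be reversed is determined by A (flip_adj_source), so every separation in N
    belongs to exactly one edge, and deleting that edge separates the
    orientations that contain A from those that do not.  Hence the graph is a
    tree.  Each point x of the ground set lies in the part of the orientation
    towards x, and the edge at which A is reversed induces the separation
    given by A.  The construction commutes with every permutation preserving
    N. *)

(** * Crossing separations and images under permutations *)

Definition cross (E : finType) (A B : {set E}) : bool :=
  [&& A :&: B != set0, A :&: ~: B != set0,
      ~: A :&: B != set0 & ~: A :&: ~: B != set0].

Lemma crossC (E : finType) (A B : {set E}) : cross A B = cross B A.
Proof.
by rewrite /cross ![B :&: _]setIC ![~: B :&: _]setIC; congr andb; rewrite andbCA.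
Qed.

Lemma crossNl (E : finType) (A B : {set E}) : cross (~: A) B = cross A B.
Proof. by rewrite /cross setCK; do 4 case: (_ == _). Qed.

Lemma crossNr (E : finType) (A B : {set E}) : cross A (~: B) = cross A B.
Proof. by rewrite crossC crossNl crossC. Qed.

Lemma imsetCperm (E : finType) (a : {perm E}) (A : {set E}) :
  a @: (~: A) = ~: (a @: A).
Proof.
apply/setP => x; rewrite -[x](permKV a) inE !mem_imset ?inE //; exact: perm_inj.
Qed.

Lemma imsetIperm (E : finType) (a : {perm E}) (A B : {set E}) :
  a @: (A :&: B) = a @: A :&: a @: B.
Proof. by apply: imsetI => x y _ _; apply: perm_inj. Qed.

Lemma imset_permV (E : finType) (a : {perm E}) (A : {set E}) :
  a @: ((a^-1)%g @: A) = A.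
Proof.
by rewrite -imset_comp -[RHS]imset_id; apply: eq_imset => x /=; rewrite permKV.
Qed.

Lemma imset_permK (E : finType) (a : {perm E}) (A : {set E}) :
  (a^-1)%g @: (a @: A) = A.
Proof. by rewrite -{2}[a]invgK imset_permV. Qed.

Lemma cross_imset (E : finType) (a : {perm E}) (A B : {set E}) :
  cross (a @: A) (a @: B) = cross A B.
Proof. by rewrite /cross -!imsetCperm -!imsetIperm !imset_eq0. Qed.

(** * The tree of a nested set of separations *)

Section NestedTree.
Variables (E : finType) (N : {set {set E}}).
Hypothesis N_setC : forall A, A \in N -> ~: A \in N.
Hypothesis N_nested : {in N &, forall A B, ~~ cross A B}.
Hypothesis N_set0 : set0 \notin N.
Implicit Types (A B : {set E}).

(** These orientations serve as the nodes of the tree: a node of a tree selects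
    for every edge the side containing it.  That selected sides meet expresses
    that no two of them point away from each other. *)
Definition consistent (O : {set {set E}}) : bool :=
  [&& O \subset N, [forall A in N, (A \in O) || (~: A \in O)]
    & [forall A in O, forall B in O, A :&: B != set0]].

Definition node := {O : {set {set E}} | consistent O}.
Implicit Types (O P Q : node).

Lemma node_sub O A : A \in val O -> A \in N.
Proof. by case/and3P: (valP O) => /subsetP h _ _; apply: h. Qed.

Lemma node_meet O A B : A \in val O -> B \in val O -> A :&: B != set0.
Proof.
case/and3P: (valP O) => _ _ /forall_inP h hA hB.
by have /forall_inP := h A hA; apply.
Qed.

Lemma node_setC O A : A \in N -> (~: A \in val O) = (A \notin val O).
Proof.
move=> hA; case/and3P: (valP O) => _ /forall_inP /(_ A hA) h _.
case: (boolP (A \in val O)) h => [hO _|_ /= -> //].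
apply/negP => hC; have := node_meet hO hC; by rewrite setICr eqxx.
Qed.

Lemma node_up O A B : A \in val O -> B \in N -> A \subset B -> B \in val O.
Proof.
move=> hA hB sAB; apply: contraT; rewrite -node_setC // => hC.
by have := node_meet hA hC; rewrite -setDE setD_eq0 sAB.
Qed.

(** Reversing A leads from O to P, and reversing ~: A leads back. *)
Definition flip_adj : rel node := fun O P =>
  [exists A, (val O :\: val P == [set A]) && (val P :\: val O == [set ~: A])].

Lemma flip_adj_sym : symmetric flip_adj.
Proof.
suff h O P : flip_adj O P -> flip_adj P O by move=> O P; apply/idP/idP; apply: h.
by case/existsP => A /andP[hA hB]; apply/existsP; exists (~: A); rewrite hB setCK.
Qed.

Lemma flip_adj_irr : irreflexive flip_adj.
Proof.
move=> O; apply/existsP => -[A /andP[/eqP/setP/(_ A)]].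
by rewrite setDv !inE eqxx.
Qed.

Lemma flip_adj_mem O P A B : flip_adj O P -> A \in val O -> A \notin val P ->
  B \in val O -> B != A -> B \in val P.
Proof.
case/existsP => A' /andP[/eqP/setP h _] hO hP hB nBA; apply: contraT => hBP.
move: (h A) (h B); rewrite !inE hO hP hB hBP /= => /esym/eqP hA /esym/eqP hB'.
by rewrite hA hB' eqxx in nBA.
Qed.

(** If B lay strictly below A in O, then B would survive the reversal of A and
    be disjoint from the new member ~: A. *)
Lemma flip_adj_minimal O P A B : flip_adj O P -> A \in val O -> A \notin val P ->
  B \in val O -> B \subset A -> B = A.
Proof.
move=> hOP hO hP hB sBA; apply/eqP; apply: contraT => nBA.
have hBP := flip_adj_mem hOP hO hP hB nBA.
by move: hP; rewrite (node_up hBP (node_sub hO) sBA).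
Qed.

(** Here nestedness enters.  Let A be a minimal member of O1 and of O2, and let
    B be in O1 but ~: B in O2.  Consistency makes A meet both B and ~: B, so, as
    A and B do not cross, B or ~: B is a subset of A, against minimality. *)
Lemma flip_adj_source O P O' P' A :
  flip_adj O P -> A \in val O -> A \notin val P ->
  flip_adj O' P' -> A \in val O' -> A \notin val P' -> O = O'.
Proof.
suff h O1 P1 O2 P2 : flip_adj O1 P1 -> A \in val O1 -> A \notin val P1 ->
    flip_adj O2 P2 -> A \in val O2 -> A \notin val P2 ->
    forall B, B \in val O1 -> B \in val O2.
  move=> a1 a2 a3 b1 b2 b3; apply/val_inj/setP => B.
  by apply/idP/idP; [apply: (h O P O' P') | apply: (h O' P' O P)].
move=> a1 a2 a3 b1 b2 b3 B hB.
have [-> //|nBA] := eqVneq B A.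
have hBN := node_sub hB; have hAN := node_sub a2.
apply: contraT; rewrite -node_setC // => hCB.
move: (N_nested hAN hBN); rewrite /cross (node_meet a2 hB) (node_meet b2 hCB) /=.
rewrite negb_and !negbK ![~: A :&: _]setIC -!setDE !setD_eq0 => /orP[s|s].
  by rewrite (flip_adj_minimal a1 a2 a3 hB s) eqxx in nBA.
have e := flip_adj_minimal b1 b2 b3 hCB s.
by move: (node_meet a2 hB); rewrite -e setIC setICr eqxx.
Qed.

Lemma node_swap O P A : A \in val O -> A \notin val P ->
  ~: A \in val P /\ ~: A \notin val O.
Proof. by move=> hO hP; rewrite !node_setC ?(node_sub hO) // hO hP. Qed.

Lemma flip_adj_edge O P O' P' A :
  flip_adj O P -> A \in val O -> A \notin val P ->
  flip_adj O' P' -> A \in val O' -> A \notin val P' -> O = O' /\ P = P'.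
Proof.
move=> a1 a2 a3 b1 b2 b3; split; first exact: flip_adj_source a1 a2 a3 b1 b2 b3.
have [c1 c2] := node_swap a2 a3; have [d1 d2] := node_swap b2 b3.
by apply: (flip_adj_source _ c1 c2 _ d1 d2); rewrite flip_adj_sym.
Qed.

Lemma flip_adj_witness O P : flip_adj O P -> exists2 A, A \in val O & A \notin val P.
Proof.
case/existsP => A /andP[/eqP/setP/(_ A) + _].
by rewrite !inE eqxx => /andP[hP hO]; exists A.
Qed.

(** Reverse in O an inclusion-minimal member A of O that is not in P.  A member
    of O strictly below A would lie in P by minimality and force A into P; hence
    the reversed orientation is still consistent. *)
Lemma flip_toward O P : O != P -> exists2 Q, flip_adj O Q &
  val O :&: val P \subset val Q /\ #|val Q :\: val P| < #|val O :\: val P|.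
Proof.
move=> nOP.
have [A0 hA0] : exists A, A \in val O :\: val P.
  apply/set0Pn; rewrite setD_eq0; apply: contra nOP => /subsetP s.
  apply/eqP/val_inj/setP => A; apply/idP/idP; first exact: s.
  move=> hP; apply: contraT; rewrite -node_setC ?(node_sub hP) // => /s.
  by rewrite node_setC ?(node_sub hP) // hP.
have [A /minsetP[hA minA] _] :=
  minset_exists (P := mem (val O :\: val P)) (C := A0) hA0.
move: hA => /=; rewrite inE => /andP[AnP AO].
have AN := node_sub AO.
have CP : ~: A \in val P by rewrite node_setC.
have CnO : ~: A \notin val O by rewrite node_setC // AO.
pose Q0 := ~: A |: (val O :\ A).
have minO B : B \in val O -> B != A -> ~: A :&: B != set0.
  move=> hB; apply: contra => /eqP e.
  have sBA : B \subset A by rewrite -setD_eq0 setDE setIC e.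
  rewrite (minA B) //= !inE hB andbT.
  apply: contra AnP => hBP; exact: node_up hBP AN sBA.
have nA0 : ~: A != set0 by apply: contraNneq N_set0 => <-; apply: N_setC.
have hQ : consistent Q0.
  apply/and3P; split.
  - apply/subsetP => B; rewrite !inE => /orP[/eqP ->|/andP[_ /node_sub //]].
    exact: N_setC.
  - apply/forall_inP => B hB; rewrite !inE.
    have [->|nBA] := eqVneq B A; first by rewrite eqxx orbT.
    have [_ //|nBC] := eqVneq B (~: A).
    rewrite (inj_eq (@setC_inj _)) (negbTE nBA) /=.
    rewrite -(inj_eq (@setC_inj _)) setCK in nBC; rewrite nBC /=.
    by rewrite node_setC ?orbN.
  - apply/forall_inP => B hB; apply/forall_inP => C hC.
    move: hB hC; rewrite !inE.
    case/orP => [/eqP->|/andP[nB hB]]; case/orP => [/eqP->|/andP[nC hC]].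
    + by rewrite setIid.
    + exact: minO.
    + by rewrite setIC minO.
    + exact: node_meet hB hC.
exists (Sub Q0 hQ); rewrite /flip_adj ?SubK.
  apply/existsP; exists A; apply/andP; split; apply/eqP/setP => B; rewrite !inE.
    have [->|_] /= := eqVneq B A; last by case: (B \in val O); rewrite ?orbT ?andbF.
    rewrite AO andbT orbF; apply/eqP => e.
    by move: CnO; rewrite -e AO.
  have [->|_] /= := eqVneq B (~: A); first by rewrite CnO.
  by case: (B \in val O); rewrite ?andbF.
split.
  apply/subsetP => B; rewrite !inE => /andP[hO hP].
  rewrite hO andbT; apply/orP; right; by apply: contraNneq AnP => <-.
rewrite (cardsD1 A (val O :\: val P)) !inE AO AnP add1n ltnS subset_leq_card //.
apply/subsetP => B; rewrite !inE => /andP[hP /orP[/eqP e|/andP[-> ->]]].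
  by rewrite e CP in hP.
by rewrite hP.
Qed.

(** The path obtained from flip_toward never reverses a side on which O and P
    agree.  The relation e is free so that the path can be found in the whole
    graph as well as in the graph with an edge removed. *)
Lemma flip_connect (e : rel node) O P :
  (forall Q R, flip_adj Q R -> val O :&: val P \subset val Q ->
     val O :&: val P \subset val R -> e Q R) ->
  connect e O P.
Proof.
have [n] := ubnP #|val O :\: val P|; elim: n O => // n IHn O le_n he.
have [->|nOP] := eqVneq O P; first exact: connect0.
have [Q hQ [sQ ltQ]] := flip_toward nOP.
have sQ' : val O :&: val P \subset val Q :&: val P by rewrite subsetI sQ subsetIr.
apply: (@connect_trans _ _ Q); first by apply/connect1/he; rewrite ?subsetIl.
apply: IHn => [|R S hRS sR sS]; first exact: leq_trans ltQ _.
by apply: he => //; apply: subset_trans sQ' _.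
Qed.

(** The only edge along which membership of A changes is the deleted one. *)
Lemma del_edge_mem O P Q R A : flip_adj O P -> A \in val O -> A \notin val P ->
  connect (del_edge flip_adj O P) Q R -> (A \in val Q) = (A \in val R).
Proof.
move=> aOP hO hP.
suff cl : closed (del_edge flip_adj O P) [pred Q : node | A \in val Q].
  by move/(closed_connect cl).
move=> {}Q {}R /andP[aQR neq] /=.
apply/idP/idP => h; apply: contraT => h'; case/negP: neq.
  by have [-> ->] := flip_adj_edge aOP hO hP aQR h h'.
rewrite flip_adj_sym in aQR.
by have [-> ->] := flip_adj_edge aOP hO hP aQR h h'; rewrite setUC.
Qed.

Lemma del_edge_component O P Q A : flip_adj O P -> A \in val O -> A \notin val P ->
  connect (del_edge flip_adj O P) O Q = (A \in val Q).
Proof.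
move=> aOP hO hP; apply/idP/idP => [/(del_edge_mem aOP hO hP) <- //|hQ].
apply: flip_connect => R S aRS /subsetP/(_ A) + /subsetP/(_ A).
rewrite inE hO hQ => /(_ isT) hR /(_ isT) hS; rewrite /del_edge /= aRS /=.
apply/eqP => /setP/(_ P); rewrite !inE eqxx orbT => /orP[] /eqP e.
  by rewrite e hR in hP.
by rewrite e hS in hP.
Qed.

Definition point_orientation (x : E) : {set {set E}} := [set A in N | x \in A].

Lemma point_orientation_consistent x : consistent (point_orientation x).
Proof.
apply/and3P; split.
- by apply/subsetP => A; rewrite inE => /andP[].
- by apply/forall_inP => A hA; rewrite !inE hA N_setC //= orbN.
- apply/forall_inP => A; rewrite inE => /andP[_ xA].
  apply/forall_inP => B; rewrite inE => /andP[_ xB].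
  by apply/set0Pn; exists x; rewrite inE xA.
Qed.

Definition point_node x : node :=
  Sub (point_orientation x) (point_orientation_consistent x).

Definition node_part O : {set E} := [set x | point_node x == O].

(** When the ground set is empty there is no point to orient towards, but then N
    is empty as well and the empty orientation is a node. *)
Lemma node_inhabited : 0 < #|[the finType of node]|.
Proof.
have [E0|/set0Pn[x _]] := eqVneq [set: E] set0; last first.
  by apply/card_gt0P; exists (point_node x).
have NE A : A \notin N.
  apply: contra N_set0; suff -> : A = set0 by [].
  by apply/eqP; rewrite -subset0 -E0 subsetT.
have c0 : consistent set0.
  apply/and3P; split; first exact: sub0set.
    by apply/forall_inP => A; rewrite (negbTE (NE A)).
  by apply/forall_inP => A; rewrite inE.
by apply/card_gt0P; exists (Sub set0 c0).
Qed.

(** The rest of a cycle through the edge xy would connect y to x without using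
    that edge, although the edge is the only place where the side reversed
    between x and y can change. *)
Lemma flip_acyclic (c : seq node) : ucycle flip_adj c -> size c <= 2.
Proof.
case: c => [|x [|y [|z p]]] //= /andP[].
rewrite /= rcons_path => /and4P[axy ayz pzp alx] /andP[xn /andP[yn _]].
have [A Ax Ay] := flip_adj_witness axy.
suff h : connect (del_edge flip_adj x y) y x.
  by have := del_edge_mem axy Ax Ay h; rewrite Ax (negbTE Ay).
have xnp : {in y :: z :: p, forall u, u != x}.
  by move=> u hu; apply: contraNneq xn => <-.
apply: (@connect_trans _ _ (last z p)).
  apply/connectP; exists (z :: p) => //.
  apply: (@sub_in_path _ [in y :: z :: p] flip_adj); last by rewrite /= ayz.
    move=> u v hu hv auv; rewrite /del_edge /= auv /=.
    apply/eqP => /setP/(_ x); rewrite !inE eqxx /= eq_sym (negbTE (xnp _ hu)).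
    by rewrite eq_sym (negbTE (xnp _ hv)).
  exact/allP.
apply: connect1; rewrite /del_edge /= alx /=.
have hl : last z p \in z :: p by apply: mem_last.
apply/eqP => /setP/(_ y); rewrite !inE eqxx orbT => /orP[/eqP e|/eqP e].
  by rewrite e hl in yn.
by rewrite -e inE eqxx in xn.
Qed.

Lemma flip_tree : tree flip_adj.
Proof.
split; first exact: flip_adj_sym.
- exact: flip_adj_irr.
- exact: node_inhabited.
- by move=> O P; apply: flip_connect.
- exact: flip_acyclic.
Qed.

Lemma node_part_partition : family_partition node_part.
Proof.
split=> [O P nOP|].
  apply/pred0P => x /=; rewrite !inE; apply/andP => -[/eqP eO /eqP eP].
  by rewrite -eO -eP eqxx in nOP.
apply/setP => x; rewrite inE; apply/bigcupP; exists (point_node x) => //.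
by rewrite inE.
Qed.

Lemma flip_edge_side O P A : flip_adj O P -> A \in val O -> A \notin val P ->
  edge_side flip_adj node_part O P = A.
Proof.
move=> aOP hO hP; apply/setP => x; apply/bigcupP/idP.
  case=> Q; rewrite (del_edge_component _ aOP hO hP) inE => hQ /eqP e.
  by move: hQ; rewrite -e inE => /andP[].
move=> xA; exists (point_node x); last by rewrite inE.
by rewrite (del_edge_component _ aOP hO hP) inE (node_sub hO).
Qed.

(** Along a path from the orientation towards a point of A to the orientation
    towards a point outside A, some edge must reverse A. *)
Lemma nested_edge A : A \in N -> exists O P, [/\ flip_adj O P,
  edge_side flip_adj node_part O P = A & edge_side flip_adj node_part P O = ~: A].
Proof.
move=> hA.
suff [O [P [aOP hO hP]]] : exists O P, [/\ flip_adj O P, A \in val O & A \notin val P].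
  exists O, P; split=> //; first exact: flip_edge_side.
  have [c1 c2] := node_swap hO hP.
  by apply: flip_edge_side; rewrite // flip_adj_sym.
have [x xA] : exists x, x \in A by apply/set0Pn; apply: contraNneq N_set0 => <-.
have [y yA] : exists y, y \in ~: A.
  by apply/set0Pn; apply: contraNneq N_set0 => <-; apply: N_setC.
have co : connect flip_adj (point_node x) (point_node y) by apply: flip_connect.
apply: boolp.contrapT => no.
have cl : closed flip_adj [pred Q : node | A \in val Q].
  move=> O P aOP /=; apply/idP/idP => h; apply: contraT => h'; case: no.
    by exists O, P.
  by exists P, O; rewrite flip_adj_sym.
have := closed_connect cl co; rewrite !inE hA xA /=.
by move: yA; rewrite inE => /negbTE ->.
Qed.

(** ** Symmetries of the nested set act on the tree *)

Section Action.
Variable G : {group {perm E}}.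
Hypothesis N_inv : forall a A, a \in G -> (a @: A \in N) = (A \in N).

Notation to2 := (('P^*)^*)%act.

Lemma to2E (O : {set {set E}}) (a : {perm E}) A : (a @: A \in to2 O a) = (A \in O).
Proof.
have -> : a @: A = ('P^*)%act A a by rewrite /= setactE.
rewrite /= setactE; apply: mem_imset; exact: act_inj.
Qed.

Lemma perm_imset_surj (a : {perm E}) A : exists B, A = a @: B.
Proof. by exists ((a^-1)%g @: A); rewrite imset_permV. Qed.

Lemma consistent_imset (O : {set {set E}}) a :
  a \in G -> consistent O -> consistent (to2 O a).
Proof.
move=> aG /and3P[/subsetP h1 /forall_inP h2 /forall_inP h3]; apply/and3P; split.
- apply/subsetP => A; have [B ->] := perm_imset_surj a A.
  by rewrite to2E N_inv //; apply: h1.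
- apply/forall_inP => A; have [B ->] := perm_imset_surj a A.
  by rewrite -imsetCperm !to2E N_inv //; apply: h2.
- apply/forall_inP => A; have [B ->] := perm_imset_surj a A; rewrite to2E => hB.
  apply/forall_inP => C; have [D ->] := perm_imset_surj a C; rewrite to2E => hD.
  by rewrite -imsetIperm imset_eq0; have /forall_inP := h3 B hB; apply.
Qed.

Lemma sub_node_dom : G \subset subact_dom consistent to2.
Proof.
apply/subsetP => a aG; rewrite /subact_dom !inE /=.
by apply/subsetP => O; rewrite !inE; apply: consistent_imset.
Qed.

(** Outside G the image of a consistent orientation of N need not orient N, so the
    natural action on sets of sets is restricted to G. *)
Definition node_action : action G node := (to2^? \ sub_node_dom)%act.

Lemma node_actionE O a : a \in G -> val (node_action O a) = to2 (val O) a.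
Proof.
move=> aG; have ad := subsetP sub_node_dom _ aG.
by rewrite /node_action /= (val_subact) ad.
Qed.

Lemma flip_adj_act O P a : a \in G ->
  flip_adj (node_action O a) (node_action P a) = flip_adj O P.
Proof.
move=> aG; rewrite /flip_adj !node_actionE //.
have h (X Y : {set {set E}}) A :
    (to2 X a :\: to2 Y a == [set a @: A]) = (X :\: Y == [set A]).
  apply/eqP/eqP => /setP e; apply/setP => B.
    by move: (e (a @: B)); rewrite !inE !to2E (inj_eq (imset_inj (@perm_inj _ a))).
  have [C ->] := perm_imset_surj a B.
  by move: (e C); rewrite !inE !to2E (inj_eq (imset_inj (@perm_inj _ a))).
apply/existsP/existsP => -[A]; last by exists (a @: A); rewrite -imsetCperm !h.
by have [B ->] := perm_imset_surj a A; rewrite -imsetCperm !h; exists B.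
Qed.

Lemma node_part_act O a : a \in G -> a @: node_part O = node_part (node_action O a).
Proof.
move=> aG; apply/setP => x.
have -> : x = a ((a^-1)%g x) by rewrite permKV.
set y := (a^-1)%g x; rewrite mem_imset; last exact: perm_inj.
rewrite !inE -[LHS]val_eqE -[RHS]val_eqE node_actionE //.
have -> : val (point_node (a y)) = to2 (val (point_node y)) a.
  apply/setP => A; have [B ->] := perm_imset_surj a A.
  by rewrite to2E !inE N_inv // mem_imset //; apply: perm_inj.
exact/esym/(inj_eq (act_inj to2 a)).
Qed.

End Action.

End NestedTree.

(** * Rank and order of separations *)

Section Rank.
Variables (E : finType) (M : matroid E).
Implicit Types (A B I J : {set E}) (a : {perm E}).

Lemma card_le_rank I A : I \subset A -> indep M I -> #|I| <= rank M A.
Proof. by move=> sIA hI; rewrite /rank leq_bigmax_cond // sIA. Qed.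

Lemma rank_basis A : exists I, [/\ I \subset A, indep M I & #|I| = rank M A].
Proof.
pose P := [pred I : {set E} | (I \subset A) && indep M I].
have h0 : P set0 by rewrite /= sub0set indep0.
rewrite /rank (@bigmax_eq_arg _ set0 P _ h0).
by case: arg_maxnP => // I /andP[sIA hI] _; exists I.
Qed.

Lemma indep_extend I A : I \subset A -> indep M I ->
  exists J, [/\ I \subset J, J \subset A, indep M J & #|J| = rank M A].
Proof.
have [n] := ubnP (rank M A - #|I|); elim: n I => // n IHn I le_n sIA hI.
have [lt|ge] := ltnP #|I| (rank M A); last first.
  by exists I; split=> //; apply/eqP; rewrite eqn_leq ge card_le_rank.
have [B [sBA hB cB]] := rank_basis A.
have [|x /setDP[xB xI] hx] := indep_augment hI hB; first by rewrite cB.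
have cx : #|x |: I| = #|I|.+1 by rewrite cardsU1 xI.
have [|||J [sxJ sJA hJ cJ]] := IHn (x |: I).
- by rewrite cx; lia.
- by rewrite subUset sub1set (subsetP sBA).
- exact: hx.
by exists J; split=> //; apply: subset_trans sxJ; apply: subsetUr.
Qed.

(** Extend a basis I of A :&: B to a basis J of A :|: B.  Then J :&: A and
    J :&: B are independent, their union is J and their intersection
    contains I. *)
Lemma rank_submod A B : rank M (A :&: B) + rank M (A :|: B) <= rank M A + rank M B.
Proof.
have [I [sI hI <-]] := rank_basis (A :&: B).
have [|J [sIJ sJ hJ <-]] := @indep_extend I (A :|: B) _ hI.
  by apply: subset_trans sI _; rewrite subIset // subsetUl.
have hA : #|J :&: A| <= rank M A.
  by apply: card_le_rank; rewrite ?subsetIr //; apply: indepS hJ; apply: subsetIl.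
have hB : #|J :&: B| <= rank M B.
  by apply: card_le_rank; rewrite ?subsetIr //; apply: indepS hJ; apply: subsetIl.
have := cardsUI (J :&: A) (J :&: B).
rewrite -setIUr (setIidPl sJ) -setIIr => e.
have : #|I| <= #|J :&: (A :&: B)| by rewrite subset_leq_card // subsetI sIJ.
by lia.
Qed.

Lemma rank_imset a A : a \in matroid_aut M -> rank M (a @: A) = rank M A.
Proof.
suff h b B : b \in matroid_aut M -> rank M B <= rank M (b @: B).
  move=> ha; apply/eqP; rewrite eqn_leq h // andbT.
  have := h (a^-1)%g (a @: A); rewrite groupV => /(_ ha).
  by rewrite imset_permK.
rewrite inE => /forallP hb; have [I [sI hI <-]] := rank_basis B.
rewrite -(card_imset I (@perm_inj _ b)); apply: card_le_rank; first exact: imsetS.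
by rewrite (eqP (hb I)).
Qed.

Definition connectivity A : nat := sep_order M A (~: A).

Lemma connectivityC A : connectivity (~: A) = connectivity A.
Proof. by rewrite /connectivity /sep_order setCK [rank M (~: A) + _]addnC. Qed.

(** Add the submodularity of the rank for A, B and for their complements; the
    subtractions in the order do not truncate, again by submodularity. *)
Lemma connectivity_submod A B :
  connectivity (A :&: B) + connectivity (A :|: B) <= connectivity A + connectivity B.
Proof.
have h C : rank M setT <= rank M C + rank M (~: C).
  by have := rank_submod C (~: C); rewrite setUCr; lia.
have := rank_submod A B; have := rank_submod (~: A) (~: B).
rewrite -setCU -setCI /connectivity /sep_order.
have := h A; have := h B; have := h (A :&: B); have := h (A :|: B); lia.
Qed.

Lemma connectivity_imset a A : a \in matroid_aut M ->
  connectivity (a @: A) = connectivity A.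
Proof. by move=> ha; rewrite /connectivity /sep_order -imsetCperm !rank_imset. Qed.

Lemma separationE A B : separation A B <-> B = ~: A.
Proof.
split=> [[hU hI]|->]; last by split; rewrite ?setUCr ?setICr.
apply/setP => x; move/setP/(_ x): hU; move/setP/(_ x): hI; rewrite !inE.
by case: (x \in A); case: (x \in B).
Qed.

End Rank.

(** * Tangles and their efficient distinguishers *)

Section Tangles.
Variables (E : finType) (M : matroid E).
Implicit Types (A B C X : {set E}) (theta phi : {set {set E} * {set E}}).
Notation lam := (connectivity M).

Definition small theta A : bool := (A, ~: A) \in theta.

Lemma small_union theta A B C : tangle M theta ->
  small theta A -> small theta B -> small theta C -> A :|: B :|: C <> setT.
Proof. by case=> k _ [_ _ _ h]; apply: h. Qed.

(** The order of a tangle stays implicit: whatever has order at most that of a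
    separation already oriented by the tangle is oriented too. *)
Lemma small_orient theta A B : tangle M theta -> small theta A ->
  lam B <= lam A -> small theta B || small theta (~: B).
Proof.
case=> k _ [h1 h2 _ _] hA le; have [_ ltA] := h2 _ _ hA.
have := h1 B (~: B); rewrite separationE => /(_ erefl (leq_ltn_trans le ltA)) c1.
have : 0 < #|theta :&: [set (B, ~: B); (~: B, B)]| by rewrite c1.
case/card_gt0P => p; rewrite !inE /small setCK => /andP[+ /orP[] /eqP e]; rewrite e.
  by move->.
by move->; rewrite orbT.
Qed.

Lemma small_sub theta A B C : tangle M theta -> small theta A -> small theta C ->
  B \subset A -> lam B <= lam C -> small theta B.
Proof.
move=> ht hA hC sBA le; case/orP: (small_orient ht hC le) => // hB.
case: (small_union ht hA hA hB); rewrite setUid; apply/setP => x; rewrite !inE.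
by have /implyP := subsetP sBA x; case: (x \in A); case: (x \in B).
Qed.

Lemma small_setU theta A B C : tangle M theta -> small theta A -> small theta B ->
  small theta C -> lam (A :|: B) <= lam C -> small theta (A :|: B).
Proof.
move=> ht hA hB hC le; case/orP: (small_orient ht hC le) => // hU.
by case: (small_union ht hA hB hU); rewrite setUCr.
Qed.

Lemma small_neqT theta A : tangle M theta -> small theta A -> A != setT.
Proof.
move=> ht hA; apply/eqP => e.
by apply: (small_union ht hA hA hA); rewrite !setUid.
Qed.

Definition splits theta phi A := small theta A && small phi (~: A).

(** Unlike the notion for unordered separations, this one fixes which side is
    small for which tangle; efficientC exchanges the two. *)
Definition efficient theta phi A : Prop :=
  [/\ tangle M theta, tangle M phi, splits theta phi A
    & forall B, splits theta phi B -> lam A <= lam B].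

Lemma splitsC theta phi A : splits theta phi A = splits phi theta (~: A).
Proof. by rewrite /splits setCK andbC. Qed.

Lemma efficientC theta phi A : efficient theta phi A -> efficient phi theta (~: A).
Proof.
case=> h1 h2 h3 h4; split=> //; first by rewrite -splitsC.
by move=> B; rewrite splitsC => /h4; rewrite !connectivityC.
Qed.

Lemma efficient_le theta phi A B : efficient theta phi A ->
  splits theta phi B -> lam B <= lam A -> efficient theta phi B.
Proof.
by case=> h1 h2 h3 h4 hB le; split=> // C /h4; apply: leq_trans.
Qed.

Definition efficient_seps : {set {set E}} :=
  [set A | boolp.asbool (exists theta phi, efficient theta phi A) ].

Lemma efficient_sepsP theta phi A : efficient theta phi A -> A \in efficient_seps.
Proof. by move=> h; rewrite inE; apply/boolp.asboolP; exists theta, phi. Qed.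

Definition crossing_number A : nat := #|[set X in efficient_seps | cross A X]|.
Notation x_ := crossing_number.

Lemma crossing_numberC A : x_ (~: A) = x_ A.
Proof. by apply: eq_card => X; rewrite !inE crossNl. Qed.

(** If X or ~: X is disjoint from A or from C, it is disjoint from the corner.
    Otherwise one of X, ~: X lies in A and one of them lies in C.  If it is the
    same one, it lies in the corner; if not, A :|: C = setT, although A and C
    cross. *)
Lemma nested_corner A C X : cross A C ->
  ~~ cross A X -> ~~ cross C X -> ~~ cross (A :&: C) X.
Proof.
case/and4P => _ _ _ hAC; rewrite /cross !negb_and !negbK.
case/or4P => /eqP hA.
- by rewrite [A :&: C :&: X]setIAC hA set0I eqxx.
- by rewrite [_ :&: _ :&: ~: X]setIAC hA set0I eqxx !orbT.
- case/or4P => /eqP hC.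
  + by rewrite -[A :&: C :&: X]setIA hC setI0 eqxx.
  + by rewrite -[_ :&: _ :&: ~: X]setIA hC setI0 eqxx !orbT.
  + by rewrite setCI setIUl hA hC setU0 eqxx !orbT.
  + case/negP: hAC; rewrite -(setIT (~: A :&: ~: C)) -(setUCr X) setIUr.
    by rewrite setIAC hA set0I set0U -setIA hC setI0.
- case/or4P => /eqP hC.
  + by rewrite -[A :&: C :&: X]setIA hC setI0 eqxx.
  + by rewrite -[_ :&: _ :&: ~: X]setIA hC setI0 eqxx !orbT.
  + case/negP: hAC; rewrite -(setIT (~: A :&: ~: C)) -(setUCr X) setIUr.
    by rewrite -setIA hC setI0 set0U setIAC hA set0I.
  + by rewrite setCI !setIUl hA hC setU0 eqxx !orbT.
Qed.

Lemma cross_corner_or A C X : cross A C ->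
  cross (A :&: C) X || cross (A :|: C) X -> cross A X || cross C X.
Proof.
move=> hAC; apply: contraTT; rewrite !negb_or => /andP[nA nC].
rewrite nested_corner //= -crossNl setCU nested_corner ?crossNl //.
by rewrite crossNr.
Qed.

(** Each quadrant of A and X contains a quadrant of one of the corners and X, and
    likewise for C. *)
Lemma cross_corner_and A C X :
  cross (A :&: C) X -> cross (A :|: C) X -> cross A X && cross C X.
Proof.
have up (Y Z : {set E}) : Z \subset Y -> Z != set0 -> Y != set0.
  by move=> s; apply: contraNneq => e; rewrite -subset0 -e.
case/and4P => h1 h2 _ _ /and4P[_ _ h3 h4]; rewrite setCU in h3 h4.
apply/andP; split; apply/and4P; split.
- by apply: up h1; rewrite setSI // subsetIl.
- by apply: up h2; rewrite setSI // subsetIl.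
- by apply: up h3; rewrite setSI // subsetIl.
- by apply: up h4; rewrite setSI // subsetIl.
- by apply: up h1; rewrite setSI // subsetIr.
- by apply: up h2; rewrite setSI // subsetIr.
- by apply: up h3; rewrite setSI // subsetIr.
- by apply: up h4; rewrite setSI // subsetIr.
Qed.

(** A separation counted for one corner is counted for A or for C, and one
    counted for both corners is counted for both A and C.  The inequality is
    strict because A itself crosses C but neither corner. *)
Lemma crossing_number_submod A C : cross A C -> A \in efficient_seps ->
  x_ (A :&: C) + x_ (A :|: C) < x_ A + x_ C.
Proof.
move=> hAC hA; pose S B := [set X in efficient_seps | cross B X].
rewrite /x_ -/(S _) -/(S A) -/(S C) -/(S (A :|: C)).
rewrite -[X in X < _]cardsUI -[X in _ < X]cardsUI.
have sI : S (A :&: C) :&: S (A :|: C) \subset S A :&: S C.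
  apply/subsetP => X; rewrite !inE => /andP[/andP[-> h1] /andP[_ h2]].
  exact: cross_corner_and.
have sU : S (A :&: C) :|: S (A :|: C) \subset (S A :|: S C) :\ A.
  apply/subsetP => X; rewrite !inE -!andb_orr => /andP[XU h].
  rewrite XU (cross_corner_or hAC h) !andbT; apply: contraTneq h => ->.
  rewrite /cross setCU setCI.
  rewrite [A :&: C :&: ~: A]setIAC setICr set0I eqxx andbF.
  by rewrite [~: A :&: ~: C :&: A]setIAC [~: A :&: A]setIC setICr set0I eqxx !andbF.
have hin : A \in S A :|: S C.
  by rewrite in_setU in_set [X in _ || X]in_set hA [cross C A]crossC hAC orbT.
move: (subset_leq_card sI) (subset_leq_card sU).
rewrite (cardsD1 A (S A :|: S C)) hin add1n.
by move=> hI hU; rewrite addSn ltnS leq_add.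
Qed.

Definition least_crossed theta phi A : Prop :=
  efficient theta phi A /\ forall B, efficient theta phi B -> x_ A <= x_ B.

Definition tangle_seps : {set {set E}} :=
  [set A | boolp.asbool (exists theta phi, least_crossed theta phi A) ].

Lemma least_crossedC theta phi A :
  least_crossed theta phi A -> least_crossed phi theta (~: A).
Proof.
case=> h1 h2; split=> [|B /efficientC/h2]; rewrite ?crossing_numberC //.
exact: efficientC.
Qed.

(** As q and q' agree on A, the corners A :|: C and A :|: ~: C still distinguish
    them whenever they have order at most lam C, and therefore have order at
    least lam C.  By submodularity the opposite corners A :&: C and A :&: ~: C
    have order at most lam A, so p and p' orient them.  Both are small for p;
    they cannot both be small for p', for which ~: A is small too. *)
Lemma efficient_corners p p' q q' A C :
  efficient p p' A -> efficient q q' C -> lam A <= lam C ->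
  small q A -> small q' A ->
  efficient p p' (A :&: C) /\ efficient q q' (A :|: C) \/
  efficient p p' (A :&: ~: C) /\ efficient q' q (A :|: ~: C).
Proof.
move=> hA; have [tp tp' /andP[pA p'A] _] := hA.
suff key r r' B : efficient r r' B -> lam A <= lam B -> small r A -> small r' A ->
    lam (A :&: B) <= lam A /\ (small p' (~: (A :&: B)) ->
      efficient p p' (A :&: B) /\ efficient r r' (A :|: B)).
  move=> hC le qA q'A.
  have [l1 k1] := key _ _ _ hC le qA q'A.
  have [|l2 k2] := key _ _ _ (efficientC hC) _ q'A qA; first by rewrite connectivityC.
  rewrite -[lam A]connectivityC in l1 l2.
  case/orP: (small_orient tp' p'A l1) => [s1|/k1]; last by left.
  case/orP: (small_orient tp' p'A l2) => [s2|/k2]; last by right.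
  case: (small_union tp' p'A s1 s2).
  by rewrite -setUA -setIUr setUCr setIT setUC setUCr.
move=> hB le rA r'A; have [tr tr' /andP[rB r'B] minB] := hB.
have sC : ~: (A :|: B) \subset ~: B by rewrite setCS subsetUr.
have hU : lam (A :|: B) <= lam B -> splits r r' (A :|: B).
  move=> leU; rewrite /splits (small_setU tr rA rB rB leU) /=.
  by apply: (small_sub tr' r'B r'B sC _); rewrite !connectivityC.
have hmin : lam B <= lam (A :|: B).
  by have [/hU/minB|/ltnW] := leqP (lam (A :|: B)) (lam B).
have sub := connectivity_submod M A B.
have leI : lam (A :&: B) <= lam A by lia.
split=> // s.
have hI : splits p p' (A :&: B).
  by rewrite /splits s andbT; apply: (small_sub tp pA pA _ leI); apply: subsetIl.
have minA : lam A <= lam (A :&: B) by case: hA => _ _ _; apply.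
have leU : lam (A :|: B) <= lam B by lia.
by split; [apply: efficient_le hA hI leI | apply: efficient_le hB (hU leU) leU].
Qed.

Lemma least_crossed_nested_agree p p' q q' A C :
  least_crossed p p' A -> least_crossed q q' C -> lam A <= lam C ->
  small q A -> small q' A -> ~~ cross A C.
Proof.
move=> [hA mA] [hC mC] le qA q'A; apply/negP => hAC.
have AU := efficient_sepsP hA.
case: (efficient_corners hA hC le qA q'A) => -[/mA h1 h2].
  have := crossing_number_submod hAC AU; move/mC: h2; lia.
have := @crossing_number_submod A (~: C); rewrite crossNr => /(_ hAC AU).
move/efficientC/mC: h2; rewrite !crossing_numberC; lia.
Qed.

(** Both corners distinguish the pair if their order is small enough, so neither
    has order below the common order of A and C; submodularity then makes both
    orders equal to it. *)
Lemma efficient_corners_same_pair p p' A C : efficient p p' A -> efficient p p' C ->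
  efficient p p' (A :&: C) /\ efficient p p' (A :|: C).
Proof.
move=> hA hC; have [tp tp' /andP[pA p'A] mA] := hA.
have [_ _ /andP[pC p'C] mC] := hC.
have e : lam A = lam C by apply/eqP; rewrite eqn_leq mA ?mC // /splits ?pA ?pC.
have hI : lam (A :&: C) <= lam A -> splits p p' (A :&: C).
  move=> le; rewrite /splits (small_sub tp pA pA _ le) ?subsetIl //= setCI.
  by apply: (small_setU tp' p'A p'C p'A); rewrite -setCI !connectivityC.
have hU : lam (A :|: C) <= lam A -> splits p p' (A :|: C).
  move=> le; rewrite /splits (small_setU tp pA pC pA le) /=.
  apply: (small_sub tp' p'A p'A); last by rewrite !connectivityC.
  by rewrite setCS subsetUl.
have gI : lam A <= lam (A :&: C).
  by have [/hI/mA|/ltnW] := leqP (lam (A :&: C)) (lam A).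
have gU : lam A <= lam (A :|: C).
  by have [/hU/mA|/ltnW] := leqP (lam (A :|: C)) (lam A).
have := connectivity_submod M A C; rewrite -e => sub.
have lI : lam (A :&: C) <= lam A by lia.
have lU : lam (A :|: C) <= lam A by lia.
by split; [apply: efficient_le hA (hI lI) lI|apply: efficient_le hA (hU lU) lU].
Qed.

Lemma least_crossed_nested_same_pair p p' A C :
  least_crossed p p' A -> efficient p p' C ->
  x_ C <= x_ A -> ~~ cross A C.
Proof.
move=> [hA mA] hC le; apply/negP => hAC.
have [/mA h1 /mA h2] := efficient_corners_same_pair hA hC.
have := crossing_number_submod hAC (efficient_sepsP hA); lia.
Qed.

(** The case analysis is on how q and q' orient A and, if they disagree, on how
    p and p' orient C.  Replacing a separation by its complement while exchanging
    its two tangles reduces everything to the two preceding lemmas. *)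
Lemma least_crossed_nested p p' q q' A C :
  least_crossed p p' A -> least_crossed q q' C -> ~~ cross A C.
Proof.
wlog le : p p' q q' A C / lam A <= lam C.
  move=> hw hA hC; have [le|/ltnW le] := leqP (lam A) (lam C); first exact: hw hA hC.
  by rewrite crossC; apply: hw hC hA.
move=> hA hC.
suff key r r' B : least_crossed r r' B -> lam B <= lam C -> small q B -> ~~ cross B C.
  have [[_ _ /andP[qC _] _] _] := hC; have [[tq _ _ _] _] := hC.
  case/orP: (small_orient tq qC le) => [|qA]; first exact: key hA le.
  by rewrite -crossNl; apply: key (least_crossedC hA) _ qA; rewrite connectivityC.
move=> hB {}le qB; have [[tr tr' /andP[rB r'B] minB] mB] := hB.
have [eC mC] := hC; have [tq tq' /andP[qC q'C] minC] := eC.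
have leN : lam B <= lam (~: C) by rewrite connectivityC.
case/orP: (small_orient tq' q'C leN) => [|q'B];
  first exact: least_crossed_nested_agree hB hC le qB.
have qsB : splits q q' B by rewrite /splits qB.
have ge := minC _ qsB; have xle : x_ C <= x_ B := mC _ (efficient_le eC qsB le).
have leN' : lam C <= lam (~: B) by rewrite connectivityC.
have eNC : lam (~: C) <= lam B by rewrite connectivityC.
case/orP: (small_orient tr rB ge) => rC; case/orP: (small_orient tr' r'B leN') => r'C.
- by rewrite crossC; apply: least_crossed_nested_agree hC hB ge rC r'C.
- apply: (least_crossed_nested_same_pair hB _ xle).
  by apply: efficient_le (proj1 hB) _ ge; rewrite /splits rC.
- rewrite -crossNr; apply: (least_crossed_nested_same_pair hB);
    last by rewrite crossing_numberC.
  by apply: efficient_le (proj1 hB) _ eNC; rewrite /splits rC setCK.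
- rewrite -crossNr crossC.
  by apply: least_crossed_nested_agree (least_crossedC hC) hB eNC rC r'C.
Qed.

Lemma tangle_seps_nested : {in tangle_seps &, forall A B, ~~ cross A B}.
Proof.
move=> A B; rewrite !inE => /boolp.asboolP[p [p' hA]] /boolp.asboolP[q [q' hB]].
exact: least_crossed_nested hA hB.
Qed.

Lemma tangle_seps_setC A : A \in tangle_seps -> ~: A \in tangle_seps.
Proof.
rewrite !inE => /boolp.asboolP[p [p' /least_crossedC hA]].
by apply/boolp.asboolP; exists p', p.
Qed.

Lemma tangle_seps_set0 : set0 \notin tangle_seps.
Proof.
rewrite inE; apply/boolp.asboolP => -[p [p' [[_ tp' /andP[_ h] _] _]]].
by have := small_neqT tp' h; rewrite setC0 eqxx.
Qed.

Lemma least_crossed_exists p p' A : tangle M p -> tangle M p' -> splits p p' A ->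
  exists B, least_crossed p p' B.
Proof.
move=> tp tp' hA.
case: (arg_minnP lam hA) => B hB minB.
have eB : boolp.asbool (efficient p p' B) by apply/boolp.asboolP.
case: (arg_minnP (P := [pred C | boolp.asbool (efficient p p' C)]) x_ eB).
move=> C /boolp.asboolP hC minC.
by exists C; split=> // D hD; apply: minC; apply/boolp.asboolP.
Qed.

(** * Invariance under automorphisms *)

(** The preimage rather than the image of a tangle, so that membership unfolds
    directly. *)
Definition pull (a : {perm E}) theta : {set {set E} * {set E}} :=
  [set p : {set E} * {set E} | (a @: p.1, a @: p.2) \in theta].

Lemma pullE a theta A B : ((A, B) \in pull a theta) = ((a @: A, a @: B) \in theta).
Proof. by rewrite inE. Qed.

Lemma small_pull a theta A : small (pull a theta) A = small theta (a @: A).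
Proof. by rewrite /small pullE imsetCperm. Qed.

Lemma pullV a theta : pull (a^-1)%g (pull a theta) = theta.
Proof. by apply/setP => -[A B]; rewrite !pullE !imset_permV. Qed.

Lemma tangle_pull a theta :
  a \in matroid_aut M -> tangle M theta -> tangle M (pull a theta).
Proof.
move=> aM [k k1 [h1 h2 h3 h4]].
have sepE A B : separation (a @: A) (a @: B) <-> separation A B.
  rewrite !separationE -imsetCperm; split=> [/imset_inj|-> //].
  by apply; apply: perm_inj.
have ordE A B : sep_order M (a @: A) (a @: B) = sep_order M A B.
  by rewrite /sep_order !rank_imset.
exists k => //; split.
- move=> A B /sepE sAB; rewrite -ordE => lt; rewrite -(h1 _ _ sAB lt).
  pose f (p : {set E} * {set E}) := (a @: p.1, a @: p.2).
  have fI : injective f.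
    have aI := imset_inj (@perm_inj _ a).
    by case=> [X Y] [X' Y'] [] /aI -> /aI ->.
  rewrite -[RHS](card_preimset _ fI); apply: eq_card => p; rewrite !inE.
  by rewrite -[p == (A, B)](inj_eq fI) -[p == (B, A)](inj_eq fI).
- by move=> A B; rewrite pullE => /h2; rewrite sepE ordE.
- by move=> x; rewrite pullE imsetCperm imset_set1 h3.
- move=> A1 B1 A2 B2 A3 B3; rewrite !pullE => i1 i2 i3 e.
  apply: h4 i1 i2 i3 _; rewrite -!imsetU e; apply/setP => x.
  by rewrite inE -[x](permKV a) mem_imset ?inE //; apply: perm_inj.
Qed.

Lemma splits_pull a p p' A : splits (pull a p) (pull a p') A = splits p p' (a @: A).
Proof. by rewrite /splits !small_pull imsetCperm. Qed.

Lemma efficient_pull a p p' A : a \in matroid_aut M -> efficient p p' (a @: A) ->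
  efficient (pull a p) (pull a p') A.
Proof.
move=> aM [tp tp' d m]; split; rewrite ?splits_pull //; try exact: tangle_pull.
by move=> B; rewrite splits_pull => /m; rewrite !connectivity_imset.
Qed.

Lemma efficient_seps_imset a A : a \in matroid_aut M ->
  (a @: A \in efficient_seps) = (A \in efficient_seps).
Proof.
suff h b B : b \in matroid_aut M -> b @: B \in efficient_seps -> B \in efficient_seps.
  move=> aM; apply/idP/idP; first exact: h.
  by move=> hA; apply: (h (a^-1)%g); rewrite ?groupV // imset_permK.
move=> bM; rewrite !inE => /boolp.asboolP[p [p' hB]]; apply/boolp.asboolP.
by exists (pull b p), (pull b p'); apply: efficient_pull.
Qed.

Lemma crossing_number_imset a A : a \in matroid_aut M -> x_ (a @: A) = x_ A.
Proof.
move=> aM; rewrite -[LHS](card_preimset _ (imset_inj (@perm_inj _ a))).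
apply: eq_card => X; rewrite [LHS]in_set [LHS]in_set [RHS]in_set.
by rewrite cross_imset efficient_seps_imset.
Qed.

Lemma tangle_seps_imset a A : a \in matroid_aut M ->
  (a @: A \in tangle_seps) = (A \in tangle_seps).
Proof.
suff h b B : b \in matroid_aut M -> b @: B \in tangle_seps -> B \in tangle_seps.
  move=> aM; apply/idP/idP; first exact: h.
  by move=> hA; apply: (h (a^-1)%g); rewrite ?groupV // imset_permK.
move=> bM; rewrite !inE => /boolp.asboolP[p [p' [hB mB]]]; apply/boolp.asboolP.
exists (pull b p), (pull b p'); split=> [|C hC]; first exact: efficient_pull.
rewrite -[x_ B](crossing_number_imset _ bM) -[x_ C](crossing_number_imset _ bM).
apply: mB; rewrite -[p](pullV b) -[p'](pullV b).
apply: efficient_pull; first by rewrite groupV.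
by rewrite imset_permK.
Qed.

End Tangles.

(** * The canonical tree-decomposition *)

Theorem theorem4 (E : finType) (M : matroid E) :
  exists (T : finType) (adj : rel T) (V : T -> {set E}),
    [/\ tree_decomposition adj V,
        canonical adj V M
      & forall theta theta' : {set {set E} * {set E}},
          tangle M theta -> tangle M theta' -> distinguishable theta theta' ->
          exists t1 t2 : T, adj t1 t2 /\
            efficiently_distinguishes M (edge_side adj V t1 t2)
              (edge_side adj V t2 t1) theta theta'].
Proof.
have NC := @tangle_seps_setC E M; have Nn := @tangle_seps_nested E M.
have N0 := tangle_seps_set0 M; have NI := @tangle_seps_imset E M.
exists [the finType of node (tangle_seps M)].
exists (@flip_adj E (tangle_seps M)), (node_part NC).
split.
- by split; [exact: flip_tree | exact: node_part_partition].
- exists (node_action (G := [the {group _} of matroid_aut M]) NI) => a aM.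
  split=> [O P|O].
    exact: flip_adj_act.
  exact: node_part_act.
move=> p q tp tq [A [B [/separationE -> dAB]]].
have [C hC] : exists C, least_crossed M p q C.
  case: dAB => -[h1 h2].
    by apply: (@least_crossed_exists _ _ _ _ A tp tq); rewrite /splits /small setCK h1.
  by apply: (@least_crossed_exists _ _ _ _ (~: A) tp tq); rewrite /splits /small setCK h1.
have CN : C \in tangle_seps M by rewrite inE; apply/boolp.asboolP; exists p, q.
have [O [P [aOP sideO sideP]]] := nested_edge NC Nn N0 CN.
exists O, P; rewrite sideO sideP; split=> //; have [[_ _ /andP[pC qC] mC] _] := hC.
split; first by split; [apply/separationE | left; split; rewrite // -{2}[C]setCK].
move=> A' B' [/separationE -> [] [h1 h2]].
  by apply: (mC A'); rewrite /splits /small setCK h1.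
rewrite -/(connectivity M C) -/(connectivity M A') -[connectivity M A']connectivityC.
by apply: mC; rewrite /splits /small setCK h1.
Qed.
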